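(* Let $d\ge2$, let $a,b\in(0,\infty)^d$ satisfy $a_k<b_k$ for every $k$, and let $0<c<1$. Put $\mu=\delta_b-c\,\delta_a$ (Dirac masses) and, for $x\in(0,\infty)^d$, $$g_{a,b,c}(x)=\mathbf 1_{\{0<x_k\le b_k\text{ for all }k\}}(x)-c\,\mathbf 1_{\{0<x_k\le a_k\text{ for all }k\}}(x),$$ which is the upper-tail potential of $\mu$. Then $$g_{a,b,c}\in\mathrm{RMGM}\left(\frac{1+c}{1-c},\mathbf 1\right),\qquad \mathbf 1=(1,\dots,1).$$ The function $g_{a,b,c}$ is nonnegative but is not nonincreasing in any coordinate for which $a_k<b_k$. It is also not a tensor product when at least two of the coordinate inequalities $a_k<b_k$ are strict.
   Context: Products of vectors are componentwise. For $r\in(0,\infty)^d$ put $\mathcal Q(r)=\prod_{k=1}^d(0,r_k)$ and $\mathcal Q^*(r)=\prod_{k=1}^d[r_k,\infty)$. Upper-tail potentials. A complex Radon measure on $(0,\infty)^d$ is understood locally (its total variation $|\mu|$ is finite on compact sets but not necessarily on the whole space). A measurable function $g:(0,\infty)^d\to\mathbb C$ is an upper-tail potential if there is a complex Radon measure $\mu_g$ on $(0,\infty)^d$ such that $g(x)=\mu_g(\mathcal Q^*(x))$ for almost every $x$ and $$\mathcal M_g(r):=\int_{(0,\infty)^d}\prod_{k=1}^d\min\{r_k,t_k\}\,d|\mu_g|(t)<\infty\quad\text{for every }r\in(0,\infty)^d.$$ The second condition implies $|\mu_g|(\mathcal Q^*(x))<\infty$ for every $x$. The measure $\mu_g$ is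 uniquely determined by the almost-everywhere class of $g$, and $g$ is always represented by its canonical version $g(x)=\mu_g(\mathcal Q^*(x))$ for every $x$. RMGM. For $K\ge1$ and $\lambda\in[1,\infty)^d$, an upper-tail potential $g$ belongs to $\mathrm{RMGM}(K,\lambda)$ if $\mathcal M_g(r)\le K\int_{\mathcal Q(\lambda r)}|g(x)|\,dx$ for every $r\in(0,\infty)^d$. Tensor product. A measurable function $F$ on $(0,\infty)^d$ is a tensor product if $F(x)=\prod_{k=1}^dF_k(x_k)$ almost everywhere for measurable one-dimensional functions $F_k$. *)

(* Defs.v *)
From HB Require Import structures.
From mathcomp Require Import all_boot all_order all_algebra.
From mathcomp Require Import complex.
From mathcomp Require Import all_classical all_reals all_analysis.

Set Implicit Arguments.
Unset Strict Implicit.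
Unset Printing Implicit Defensive.
Import Order.TTheory GRing.Theory Num.Theory.
Import numFieldNormedType.Exports.
Local Open Scope classical_set_scope.
Local Open Scope ring_scope.

(* R^d is the type d.-tuple R with the library's measurable structure, the
   sigma-algebra generated by the coordinates (that is, the Borel one).
   Functions on (0,oo)^d are functions on d.-tuple R; only their values at
   points with positive coordinates are ever used. *)

Section lebesgue_step.
Local Open Scope ereal_scope.
Context {R : realType} (n : nat).

Definition consT (p : R * n.-tuple R) : n.+1.-tuple R := [tuple of p.1 :: p.2].

Lemma measurable_consT : measurable_fun [set: R * n.-tuple R] consT.
Proof.
exact: (@measurable_cons _ _ (R * n.-tuple R)%type R fst n snd).
Qed.

Variable mu : {sigma_finite_measure set (n.-tuple R) -> \bar R}.

Definition lebesgue_cons : set (n.+1.-tuple R) -> \bar R :=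
  pushforward (@lebesgue_measure R \x mu) consT.

Let lebesgue_cons0 : lebesgue_cons set0 = 0.
Proof. by rewrite /lebesgue_cons /pushforward preimage_set0 measure0. Qed.

Let lebesgue_cons_ge0 A : 0 <= lebesgue_cons A.
Proof. by rewrite /lebesgue_cons /pushforward measure_ge0. Qed.

Let lebesgue_cons_sigma_additive : semi_sigma_additive lebesgue_cons.
Proof.
move=> F mF tF mUF; rewrite /lebesgue_cons /pushforward preimage_bigcup.
apply: measure_semi_sigma_additive.
- by move=> k; have := measurable_consT measurableT (mF k); rewrite setTI.
- apply/trivIsetP => i j _ _ ij; rewrite -preimage_setI.
  by move/trivIsetP : tF => -> //; rewrite preimage_set0.
- rewrite -preimage_bigcup.
  by have := measurable_consT measurableT mUF; rewrite setTI.
Qed.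

HB.instance Definition _ := isMeasure.Build _ _ _ lebesgue_cons
  lebesgue_cons0 lebesgue_cons_ge0 lebesgue_cons_sigma_additive.

Let lebesgue_cons_sigma_finite : sigma_finite setT lebesgue_cons.
Proof.
have /sigma_finiteP[F [TF ndF Foo]] := sigma_finiteT (@lebesgue_measure R).
have /sigma_finiteP[G [TG ndG Goo]] := sigma_finiteT mu.
have mhead : measurable_fun [set: n.+1.-tuple R] (@thead n R).
  exact: (@measurable_tnth _ R n.+1 ord0).
have mtail : measurable_fun [set: n.+1.-tuple R]
    (fun t => [tuple of behead t] : n.-tuple R).
  exact: measurable_behead.
exists (fun k => @thead n R @^-1` F k `&`
  (fun t : n.+1.-tuple R => [tuple of behead t] : n.-tuple R) @^-1` G k).
  apply/esym; rewrite -subTset => t _.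
  have [i _ Fi] : (\bigcup_k F k) (thead t) by rewrite -TF.
  have [j _ Gj] : (\bigcup_k G k) [tuple of behead t] by rewrite -TG.
  exists (maxn i j) => //; split.
    by have /subsetPset := ndF _ _ (leq_maxl i j); apply.
  by have /subsetPset := ndG _ _ (leq_maxr i j); apply.
move=> k; have [mF Fkoo] := Foo k; have [mG Gkoo] := Goo k; split.
  apply: measurableI.
    by have := mhead measurableT _ mF; rewrite setTI.
  by have := mtail measurableT _ mG; rewrite setTI.
rewrite /lebesgue_cons /pushforward (_ : _ @^-1` _ = F k `*` G k).
  by rewrite product_measure1E// lte_mul_pinfty// ge0_fin_numE.
apply/seteqP; split => -[x t] /=; rewrite /consT theadE /= => -[Fx].
  by rewrite (_ : [tuple of _] = t)//; exact/val_inj.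
by move=> Gt; split=> //; rewrite (_ : [tuple of _] = t)//; exact/val_inj.
Qed.

HB.instance Definition _ := Measure_isSigmaFinite.Build _ _ _ lebesgue_cons
  lebesgue_cons_sigma_finite.

End lebesgue_step.

Fixpoint lebesgueN {R : realType} (n : nat) :
    {sigma_finite_measure set (n.-tuple R) -> \bar R} :=
  match n with
  | 0 => \d_[tuple]
  | n'.+1 => lebesgue_cons (lebesgueN n')
  end.

(* The volume of a box, which characterizes lebesgueN. *)
Lemma lebesgueN_box {R : realType} (n : nat) (A : 'I_n -> set R) :
  (forall k, measurable (A k)) ->
  lebesgueN n [set x | forall k, A k (tnth x k)] =
  (\prod_(k < n) lebesgue_measure (A k))%E.
Proof.
elim: n A => [|n IHn] A mA.
  rewrite big_ord0 /= diracE mem_set//; by case.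
rewrite big_ord_recl /=.
have mB : measurable
    [set x : n.-tuple R | forall k, A (lift ord0 k) (tnth x k)].
  rewrite (_ : [set _ | _] = \bigcap_(k in [set: 'I_n])
    [set x : n.-tuple R | A (lift ord0 k) (tnth x k)]); last first.
    by apply/seteqP; split => x /= Ax k => [_|]; exact: Ax.
  apply: fin_bigcap_measurable => // k _.
  have := @measurable_tnth _ R n k measurableT _ (mA (lift ord0 k)).
  by rewrite setTI.
rewrite -(IHn (fun k => A (lift ord0 k)))//.
apply: etrans (product_measure1E lebesgue_measure (lebesgueN n) (mA ord0) mB).
rewrite /lebesgue_cons /pushforward.
congr (product_measure1 _ _ _); apply/seteqP; split => [[x t] /= Ax|[x t]].
  split => [|k]; first exact: (Ax ord0).
  by have := Ax (lift ord0 k); rewrite tnthS.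
move=> [/= Ax At] k; have [j|] := unliftP ord0 k; move=> -> //.
by rewrite tnthS.
Qed.

Section upper_tail.
Context {R : realType} {d : nat}.
Implicit Types (x r lam : d.-tuple R) (A : set (d.-tuple R)).
Implicit Types (mu : set (d.-tuple R) -> R[i]) (g : d.-tuple R -> R[i]).

Definition orthant : set (d.-tuple R) := [set x | forall k, 0 < tnth x k].

(* Q(r) and Q*(r). *)
Definition lower_box r : set (d.-tuple R) :=
  [set x | forall k, 0 < tnth x k < tnth r k].
Definition upper_box r : set (d.-tuple R) :=
  [set x | forall k, tnth r k <= tnth x k].

Definition mulT x y : d.-tuple R := [tuple tnth x k * tnth y k | k < d].

(* Tuples carry no topology in the library, row vectors do. *)
Definition compactT A := compact [set \row_k tnth x k | x in A].

Definition relatively_compact A :=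
  exists K, [/\ compactT K, K `<=` orthant & A `<=` K].

(* The total variation |mu|, for mu defined on the relatively compact Borel
   subsets of (0,oo)^d. Every Borel set is a countable disjoint union of such
   sets, so it suffices to take the supremum over their finite disjoint
   families inside A. Points outside (0,oo)^d carry no mass. *)
Definition total_variation mu A : \bar R :=
  ereal_sup [set v | exists m (F : 'I_m -> set (d.-tuple R)),
    [/\ forall i, [/\ measurable (F i), relatively_compact (F i) & F i `<=` A],
        trivIset [set: 'I_m] F &
        v = (\sum_(i < m) Normc.normc (mu (F i)))%:E]].

(* A local complex Radon measure is a set function that is countably additive
   on relatively compact Borel sets, its values elsewhere being irrelevant.
   Regularity is automatic on (0,oo)^d. *)
Definition complex_radon mu :=
  (forall F : nat -> set (d.-tuple R),
     (forall n, measurable (F n)) -> trivIset [set: nat] F ->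
     relatively_compact (\bigcup_n F n) ->
     (fun n => \sum_(i < n) mu (F i) : R[i]^o) @ \oo
       --> (mu (\bigcup_n F n) : R[i]^o)) /\
  (forall K, compactT K -> K `<=` orthant -> (total_variation mu K < +oo)%E).

(* The compact boxes [1/(n+1), n+1]^d, which exhaust (0,oo)^d. *)
Definition exhaustion (n : nat) : set (d.-tuple R) :=
  [set x | forall k, n.+1%:R^-1 <= tnth x k <= n.+1%:R].

(* mu(A) = z for a Borel set A of finite variation that is not necessarily
   relatively compact. The limit does not depend on the exhaustion. *)
Definition has_mass mu A (z : R[i]) :=
  (fun n => mu (A `&` exhaustion n) : R[i]^o) @ \oo --> (z : R[i]^o).

(* M_g(r), as a function of mu_g. *)
Definition majorant mu r : \bar R :=
  (\int[total_variation mu]_(t in orthant)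
     (\prod_(k < d) Num.min (tnth r k) (tnth t k))%:E)%E.

Definition measurable_complex d' (T : measurableType d') (D : set T)
    (f : T -> R[i]) :=
  measurable_fun D (fun t => complex.Re (f t)) /\
  measurable_fun D (fun t => complex.Im (f t)).

Definition upper_tail_potential mu g :=
  [/\ complex_radon mu, measurable_complex orthant g,
      {ae lebesgueN d, forall x, orthant x -> has_mass mu (upper_box x) (g x)} &
      forall r, orthant r -> (majorant mu r < +oo)%E].

Definition canonical_potential mu g :=
  upper_tail_potential mu g /\
  forall x, orthant x -> has_mass mu (upper_box x) (g x).

(* mu_g is determined by the almost-everywhere class of g, so "exists mu" and
   "for the mu representing g" agree. *)
Definition RMGM (K : R) lam g :=
  [/\ 1 <= K, forall k, 1 <= tnth lam k &
    exists2 mu, canonical_potential mu g &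
      forall r, orthant r ->
        (majorant mu r <=
         K%:E * \int[lebesgueN d]_(x in lower_box (mulT lam r))
                  (Normc.normc (g x))%:E)%E].

Definition tensor_product g :=
  measurable_complex orthant g /\
  exists2 F : 'I_d -> R -> R[i],
    forall k, measurable_complex [set t : R | 0 < t] (F k) &
    {ae lebesgueN d, forall x, orthant x -> g x = \prod_(k < d) F k (tnth x k)}.

(* The order of R[i] holds only between numbers with equal imaginary parts. *)
Definition nonincreasing_in (k : 'I_d) g :=
  forall x y, orthant x -> orthant y ->
    (forall j, j != k -> tnth x j = tnth y j) -> tnth x k <= tnth y k ->
    g y <= g x.

End upper_tail.

Section two_boxes.
Local Open Scope complex_scope.
Context {R : realType} {d : nat} (a b : d.-tuple R) (c : R).

Definition mu_abc (A : set (d.-tuple R)) : R[i] :=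
  (fine (\d_b A))%:C - c%:C * (fine (\d_a A))%:C.

Definition g_abc (x : d.-tuple R) : R[i] :=
  \1_[set y : d.-tuple R | forall k, 0 < tnth y k <= tnth b k] x
  - c%:C * \1_[set y : d.-tuple R | forall k, 0 < tnth y k <= tnth a k] x.

End two_boxes.

(* Main.v *)
Require Import Defs.
From HB Require Import structures.
From mathcomp Require Import all_boot all_order all_algebra.
From mathcomp Require Import complex lra.
From mathcomp Require Import all_classical all_reals all_analysis.
Import measurable_realfun.
Set Implicit Arguments.
Unset Strict Implicit.
Unset Printing Implicit Defensive.
Import Order.TTheory GRing.Theory Num.Theory.
Local Open Scope classical_set_scope.
Local Open Scope ring_scope.

(** Write [B_e] for the box of points [x] with [0 < x_k <= e_k] for all [k].
Up to the embedding of the reals in the complex numbers, [g] is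
[1_(B_b) - c 1_(B_a)], and [B_a] is contained in [B_b], so [g] is
nonnegative because [c <= 1].

Potential and RMGM.  The point masses at [a] and [b] are distinct, so the
total variation of [delta_b - c delta_a] is [delta_b + c delta_a]
([total_variation_abc]).  With [P_e = \prod_k min(r_k, e_k)] this gives
[M_g(r) = P_b + c P_a] ([majorant_abc]).  On the other side [P_e] is exactly
the volume of [B_e] intersected with [Q(r)], and [g = |g|], so that the
integral of [|g|] over [Q(r)] is [P_b - c P_a] ([integral_g_abc]).  As
[P_a <= P_b], the bound
[(1 - c) (P_b + c P_a) <= (1 + c) (P_b - c P_a)] holds: the difference of the
two sides is [2 c (P_b - P_a)].

Monotonicity.  Raising the [k]-th coordinate of [a] to [b_k] leaves [B_a] but
not [B_b], so [g] jumps up from [1 - c] to [1].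

Tensor products.  Given points [s] and [t], the values of a product function
on the [2^d] points with coordinates taken from [s] or [t] satisfy
[g(A) g(B) = g(A u B) g(A n B)], where [A] is the set of the coordinates taken
from [t].  When [s] is in [B_a] and [a_k < t_k <= b_k] for all [k], the value
of [g] is [1 - c] if [A] is empty and [1] otherwise; two distinct singletons
then give [1 = 1 - c].  A tensor product factors only almost everywhere, so
[s] and [t] have to be chosen such that all [2^d] points avoid a given null
set; a coordinatewise use of Tonelli's theorem provides them
([ae_lebesgueN_grid]). *)

(** * Borel sets and null sets of tuples *)

Lemma measurable_tuple_box (R : realType) (n : nat) (A : 'I_n -> set R) :
  (forall k, measurable (A k)) ->
  measurable [set x : n.-tuple R | forall k, A k (tnth x k)].
Proof.
move=> mA.
rewrite (_ : [set _ | _] = \bigcap_(k in [set: 'I_n])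
    [set x : n.-tuple R | A k (tnth x k)]); last first.
  by apply/seteqP; split => x /= Ax k => [_|]; exact: Ax.
apply: fin_bigcap_measurable => // k _.
by have := @measurable_tnth _ R n k measurableT _ (mA k); rewrite setTI.
Qed.

Lemma measurable_tuple_set1 (R : realType) (n : nat) (t : n.-tuple R) :
  measurable [set t].
Proof.
rewrite (_ : [set t] = [set x | forall k, [set tnth t k] (tnth x k)]).
  apply: (@measurable_tuple_box _ _ (fun k => [set tnth t k])) => k.
  exact: measurable_set1.
apply/seteqP; split=> [x -> //|x /= xt].
by apply: eq_from_tnth => k; rewrite xt.
Qed.

(** Tonelli's theorem for null sets: the measures of the sections of a null set
integrate to zero, so almost all of them vanish. *)
Lemma ae_lebesgueN_cons (R : realType) (n : nat) (P : n.+1.-tuple R -> Prop) :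
  {ae lebesgueN n.+1, forall x, P x} ->
  {ae @lebesgue_measure R, forall u,
    {ae lebesgueN n, forall x, P (consT (u, x))}}.
Proof.
move=> [N [mN N0 PN]].
pose N' := @consT R n @^-1` N.
have mN' : measurable N'.
  by have := @measurable_consT R n measurableT _ mN; rewrite setTI.
have mf := measurable_fun_xsection (lebesgueN n) mN'.
have := (@ae_eq_integral_abs _ _ _ (@lebesgue_measure R) _ measurableT _ mf).1.
have -> : (\int[@lebesgue_measure R]_x `|(lebesgueN n \o xsection N') x| = 0)%E.
  rewrite -[RHS]N0 /= /lebesgue_cons /pushforward /product_measure1.
  by apply: eq_integral => x _; rewrite gee0_abs//.
move=> /(_ erefl); apply: filterS => u /= /(_ I) Nu0.
exists (xsection N' u); split=> //; first exact: measurable_xsection.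
by move=> x /= nP; rewrite /xsection/= inE; exact: PN.
Qed.

Lemma nonnull_ae_exists (d : measure_display) (T : measurableType d) (R : realType)
    (mu : {measure set T -> \bar R}) (P : T -> Prop) (A : set T) :
  measurable A -> mu A != 0%E -> {ae mu, forall x, P x} ->
  exists2 x, A x & P x.
Proof.
move=> mA A0 [N [mN N0 PN]]; apply: contrapT => nAP.
move/negP: A0; apply; rewrite -measure_le0 -N0.
apply: le_measure; rewrite ?inE// => x Ax.
by apply: PN => /= Px; apply: nAP; exists x.
Qed.

(** A property that holds almost everywhere holds on all vertices of some box
with prescribed nonnull sides.  By induction on the dimension: for almost all
values of the first coordinate the section of the property holds almost
everywhere; two such values [s0] and [t0] are chosen, and the induction
hypothesis is applied to the conjunction of their two sections. *)
Lemma ae_lebesgueN_grid (R : realType) (n : nat) (P : n.-tuple R -> Prop)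
    (S T : 'I_n -> set R) :
  (forall k, measurable (S k) /\ lebesgue_measure (S k) != 0%E) ->
  (forall k, measurable (T k) /\ lebesgue_measure (T k) != 0%E) ->
  {ae lebesgueN n, forall x, P x} ->
  exists s t : n.-tuple R,
    [/\ forall k, S k (tnth s k), forall k, T k (tnth t k) &
     forall x : n.-tuple R,
       (forall k, tnth x k = tnth s k \/ tnth x k = tnth t k) -> P x].
Proof.
elim: n P S T => [|n IHn] P S T HS HT.
  move=> aeP; exists [tuple], [tuple]; split; [by case..|].
  move=> x _; rewrite tuple0.
  have [] := @nonnull_ae_exists _ _ _ _ P setT measurableT _ aeP.
    by rewrite /= diracT.
  by move=> y _; rewrite tuple0.
move=> /ae_lebesgueN_cons aeP.
have [mS nS] := HS ord0.
have [s0 Ss0 Ps0] :=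
  @nonnull_ae_exists _ _ R (@lebesgue_measure R) _ _ mS nS aeP.
have [mT nT] := HT ord0.
have [t0 Tt0 Pt0] :=
  @nonnull_ae_exists _ _ R (@lebesgue_measure R) _ _ mT nT aeP.
have aeP' : {ae lebesgueN n, forall x, P (consT (s0, x)) /\ P (consT (t0, x))}.
  by apply: filterS2 Ps0 Pt0 => x /= ? ?; split.
have [s [t [Ss Tt Pst]]] := IHn _ (fun k => S (lift ord0 k))
  (fun k => T (lift ord0 k)) (fun k => HS _) (fun k => HT _) aeP'.
exists (consT (s0, s)), (consT (t0, t)).
split.
- by move=> k; have [j|] := unliftP ord0 k => ->//; rewrite tnthS.
- by move=> k; have [j|] := unliftP ord0 k => ->//; rewrite tnthS.
case/tupleP => x0 x Hx.
have [Ps Pt] : P (consT (s0, x)) /\ P (consT (t0, x)).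
  by apply: Pst => k; have := Hx (lift ord0 k); rewrite !tnthS.
by have [] := Hx ord0; rewrite /consT !tnth0 => ->.
Qed.

(** * The function and the measure as combinations of indicators *)

(** Closed relatively to the orthant only: the faces [x_k = 0] are excluded. *)
Definition closed_box (R : realType) (d : nat) (b : d.-tuple R) :
    set (d.-tuple R) :=
  [set y | forall k, 0 < tnth y k <= tnth b k].

Lemma closed_boxE (R : realType) (d : nat) (b x : d.-tuple R) :
  orthant x -> (x \in closed_box b) = (b \in upper_box x).
Proof.
move=> x0; apply/idP/idP; rewrite !inE => H k; first by case/andP: (H k).
by rewrite x0 H.
Qed.

Lemma measurable_closed_box (R : realType) (d : nat) (b : d.-tuple R) :
  measurable (closed_box b).
Proof.
rewrite (_ : closed_box b =
    [set x | forall k, `]0%R, tnth b k]%classic (tnth x k)]).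
  apply: (@measurable_tuple_box _ _ (fun k => `]0%R, tnth b k]%classic)) => k.
  exact: measurable_itv.
by apply/seteqP; split=> x bx k; have := bx k; rewrite /= in_itv.
Qed.

Lemma g_abcE (R : realType) (d : nat) (a b : d.-tuple R) (c : R) x :
  g_abc a b c x = (\1_(closed_box b) x - c * \1_(closed_box a) x)%:C%C.
Proof.
by rewrite rmorphB rmorphM /g_abc /indic !rmorph_nat.
Qed.

Lemma mu_abcE (R : realType) (d : nat) (a b : d.-tuple R) (c : R) A :
  mu_abc a b c A = (\1_A b - c * \1_A a)%:C%C.
Proof. by rewrite rmorphB rmorphM. Qed.

Lemma normc_real (R : rcfType) (x : R) : Normc.normc x%:C%C = `|x|.
Proof. by rewrite /= expr0n addr0 sqrtr_sqr. Qed.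

(** * Total variation and majorant *)

Lemma sum_indic_trivIset (R : realType) (T : Type) (m : nat)
    (F : 'I_m -> set T) (x : T) :
  trivIset setT F ->
  \sum_(i < m) \1_(F i) x = \1_(\bigcup_i F i) x :> R.
Proof.
move=> /trivIsetP tF; rewrite [RHS]indicE.
have [|nx] := boolP (x \in _).
  rewrite inE => -[i _ Fix].
  rewrite (bigD1 i)//= indicE mem_set// big1 ?addr0// => j ji.
  rewrite indicE memNset// => Fjx.
  by have : (F j `&` F i) x by []; rewrite tF.
rewrite big1// => i _; rewrite indicE memNset// => Fix.
by move/negP: nx; apply; rewrite inE; exists i.
Qed.

Lemma indic_sub (R : realType) (T : Type) (A B : set T) x :
  A `<=` B -> \1_A x <= \1_B x :> R.
Proof.
move=> AB; rewrite !indicE; have [xA|//] := boolP (x \in A).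
by rewrite (@mem_set _ B x)//; apply: AB; rewrite inE in xA.
Qed.

Lemma relatively_compact_sub1 (R : realType) (d : nat) (x : d.-tuple R) A :
  orthant x -> A `<=` [set x] -> relatively_compact A.
Proof.
move=> x0 Ax; exists [set x]; split=> //; last by move=> y ->.
by rewrite /compactT image_set1; exact: compact_set1.
Qed.

(** The supremum is attained by the family made of [A] intersected with [{b}]
and with [{a}]; these two sets are Borel and relatively compact whatever [A]
is.  Equality on all sets is what identifies the total variation with a sum of
Dirac masses, against which integrals are evaluations. *)
Lemma total_variation_abc (R : realType) (d : nat) (a b : d.-tuple R) (c : R)
    (A : set (d.-tuple R)) :
  orthant a -> orthant b -> a != b -> 0 <= c ->
  Defs.total_variation (mu_abc a b c) A = (\1_A b + c * \1_A a)%:E.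
Proof.
move=> a0 b0 ab c0; apply/eqP; rewrite eq_le; apply/andP; split.
  apply: ge_ereal_sup => _ [m [F [FA tF ->]]]; rewrite lee_fin.
  have FsubA : \bigcup_i F i `<=` A.
    by move=> x [i _ Fx]; have [_ _] := FA i; apply.
  apply: (@le_trans _ _ (\sum_(i < m) (\1_(F i) b + c * \1_(F i) a))).
    apply: ler_sum => i _; rewrite mu_abcE normc_real.
    apply: le_trans (ler_normB _ _) _.
    by rewrite !ger0_norm// mulr_ge0.
  rewrite big_split -mulr_sumr/= !sum_indic_trivIset//.
  by rewrite lerD// ?ler_wpM2l// indic_sub.
apply: ereal_sup_ubound.
exists 2, (fun i : 'I_2 => A `&` [set if i == ord0 then b else a]); split.
- move=> i; set y := if _ then b else a.
  have y0 : orthant y by rewrite /y; case: ifP.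
  split; last exact: subIsetl.
    have [yA|yA] := pselect (A y).
      by rewrite setIidr ?sub1set ?inE//; exact: measurable_tuple_set1.
    rewrite (_ : _ `&` _ = set0)//.
    by apply/seteqP; split => // z [] /[swap] -> .
  exact: (relatively_compact_sub1 y0).
- move=> [[|[|//]] ?] [[|[|//]] ?] _ _ [z [[_ /= +] [_ /=]]]
    => -> => [_|/eqP|/esym/eqP|_].
  + exact: val_inj.
  + by rewrite eq_sym (negbTE ab).
  + by rewrite eq_sym (negbTE ab).
  + exact: val_inj.
congr (_%:E); rewrite !big_ord_recl big_ord0 addr0 !mu_abcE !normc_real/=.
have E x y : \1_(A `&` [set x]) y = \1_A y * (x == y)%:R :> R.
  rewrite !indicE in_setI -natrM mulnb; congr ((_ && _)%:R).
  by apply/idP/eqP; rewrite inE.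
rewrite !E !eqxx (negbTE ab) eq_sym (negbTE ab) !mulr0 !mulr1 subr0 sub0r.
by rewrite normrN !ger0_norm// mulr_ge0.
Qed.

Lemma majorant_abc (R : realType) (d : nat) (a b : d.-tuple R) (c : R) r :
  orthant a -> orthant b -> a != b -> 0 <= c -> orthant r ->
  majorant (mu_abc a b c) r =
  (\prod_(k < d) Num.min (tnth r k) (tnth b k)
   + c * \prod_(k < d) Num.min (tnth r k) (tnth a k))%:E.
Proof.
move=> a0 b0 ab c0 r0; rewrite /majorant.
have -> : Defs.total_variation (mu_abc a b c) =
    measure_add (dirac b) (mscale (NngNum c0) (dirac a)).
  apply/funext => A; rewrite total_variation_abc//.
  by rewrite measure_addE /mscale/= !diracE.
have mO : measurable (@orthant R d).
  rewrite (_ : orthant =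
      [set x | forall k, `]0%R, +oo[%classic (tnth x k)]).
    apply: (@measurable_tuple_box _ _ (fun=> `]0%R, +oo[%classic)) => k.
    exact: measurable_itv.
  by apply/seteqP; split=> x x0 k; have := x0 k; rewrite /= in_itv/= andbT.
have mf : measurable_fun (@orthant R d)
    ((fun t => (\prod_(k < d) Num.min (tnth r k) (tnth t k))%:E)
     : d.-tuple R -> \bar R).
  apply/measurable_EFinP; apply: measurable_prod => k _.
  apply: measurable_minr => //.
  by apply: measurable_funTS; exact: measurable_tnth.
have f0 t : orthant t ->
    (0 <= (\prod_(k < d) Num.min (tnth r k) (tnth t k))%:E)%E.
  by move=> t0; rewrite lee_fin prodr_ge0// => k _; rewrite le_min !ltW.
rewrite ge0_integral_measure_add// ge0_integral_mscale//.
by rewrite !integral_dirac// !diracE !mem_set// !mul1e EFinD EFinM.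
Qed.

(** * The canonical potential *)

Lemma closed_box_sub (R : realType) (d : nat) (a b : d.-tuple R) :
  (forall k, tnth a k <= tnth b k) -> closed_box a `<=` closed_box b.
Proof.
by move=> ab x xa k; have /andP[-> /le_trans->] := xa k.
Qed.

Lemma closed_box_indic_gap (R : realType) (d : nat) (a b : d.-tuple R) (c : R)
    x :
  (forall k, tnth a k <= tnth b k) -> 0 <= c <= 1 ->
  0 <= \1_(closed_box b) x - c * \1_(closed_box a) x :> R.
Proof.
move=> /closed_box_sub ab /andP[c0 c1]; rewrite subr_ge0.
apply: le_trans (indic_sub R x ab).
by rewrite ler_piMl.
Qed.

(** At most one term of a disjoint family contains [x], so the partial sums are
eventually constant; this gives countable additivity of point masses in any
topology on the values. *)
Lemma near_sum_indic_bigcup (R : realType) (T : Type) (F : nat -> set T) x :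
  trivIset setT F ->
  \forall n \near \oo, \sum_(i < n) \1_(F i) x = \1_(\bigcup_i F i) x :> R.
Proof.
move=> tF.
have tF' n : trivIset [set: 'I_n] (fun i => F i).
  by move=> i j _ _ /(tF i j I I) /val_inj.
have [[i _ Fix]|nx] := pselect ((\bigcup_i F i) x).
  exists i.+1 => // n /= lt_in.
  rewrite (sum_indic_trivIset R x (tF' n)) !indicE !mem_set//.
    by exists i.
  by exists (Ordinal lt_in).
apply: nearW => n; rewrite big1 ?indicE ?memNset// => i _.
by rewrite indicE memNset// => Fix; apply: nx; exists i.
Qed.

Lemma exhaustion_near (R : realType) (d : nat) (x : d.-tuple R) :
  orthant x -> \forall n \near \oo, @exhaustion R d n x.
Proof.
move=> x0.
have H k : \forall n \near \oo, n.+1%:R^-1 <= tnth x k <= n.+1%:R.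
  near=> n; apply/andP; split; near: n.
    exists (Num.truncn (tnth x k)^-1) => // n /= hn.
    rewrite invf_ple ?posrE// ?ltr0n//.
    apply/ltW; apply: lt_le_trans (truncnS_gt _) _.
    by rewrite ler_nat.
  exists (Num.truncn (tnth x k)) => // n /= hn.
  apply/ltW; apply: lt_le_trans (truncnS_gt _) _.
  by rewrite ler_nat.
exact: filter_forall.
Unshelve. all: by end_near. Qed.

(** As soon as the exhausting box contains [a] and [b], intersecting with it
does not change the mass. *)
Lemma has_mass_abc (R : realType) (d : nat) (a b : d.-tuple R) (c : R) x :
  orthant a -> orthant b -> orthant x ->
  has_mass (mu_abc a b c) (upper_box x) (g_abc a b c x).
Proof.
move=> a0 b0 x0; apply: cvg_near_cst.
near=> n; rewrite mu_abcE g_abcE.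
have E y : exhaustion n y ->
    \1_(upper_box x `&` exhaustion n) y = \1_(closed_box y) x :> R.
  by move=> ny; rewrite !indicE closed_boxE// in_setI (mem_set ny) andbT.
by rewrite !E//; near: n; exact: exhaustion_near.
Unshelve. all: by end_near. Qed.

Lemma complex_radon_abc (R : realType) (d : nat) (a b : d.-tuple R) (c : R) :
  orthant a -> orthant b -> a != b -> 0 <= c -> complex_radon (mu_abc a b c).
Proof.
move=> a0 b0 ab c0; split; last first.
  by move=> K _ _; rewrite total_variation_abc// ltry.
move=> F _ tF _; apply: cvg_near_cst; near=> n.
under eq_bigr do rewrite mu_abcE.
rewrite mu_abcE -rmorph_sum sumrB -mulr_sumr.
congr ((_ - _ * _)%:C%C); near: n; exact: near_sum_indic_bigcup.
Unshelve. all: by end_near. Qed.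

Lemma measurable_g_abc (R : realType) (d : nat) (a b : d.-tuple R) (c : R) D :
  measurable_complex D (g_abc a b c).
Proof.
split.
  apply: (eq_measurable_fun
    (fun x => \1_(closed_box b) x - c * \1_(closed_box a) x : R)).
    by move=> x _; rewrite g_abcE.
  by apply: measurable_funB; [|apply: measurable_funM => //];
    apply: measurable_indic; exact: measurable_closed_box.
apply: (eq_measurable_fun (fun=> 0 : R)) => [x _|//].
by rewrite g_abcE.
Qed.

Lemma canonical_potential_abc (R : realType) (d : nat) (a b : d.-tuple R)
    (c : R) :
  orthant a -> orthant b -> a != b -> 0 <= c ->
  canonical_potential (mu_abc a b c) (g_abc a b c).
Proof.
move=> a0 b0 ab c0; have gm x := @has_mass_abc R d a b c x a0 b0.
split=> //; split=> //.
- exact: complex_radon_abc.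
- exact: measurable_g_abc.
- exact: aeW.
- by move=> r r0; rewrite majorant_abc// ltry.
Qed.

(** * The integral of the potential and the reverse bound *)

Lemma lebesgueN_box_cap (R : realType) (d : nat) (r b : d.-tuple R) :
  orthant r -> orthant b ->
  lebesgueN d (closed_box b `&` lower_box r) =
  (\prod_(k < d) Num.min (tnth r k) (tnth b k))%:E.
Proof.
move=> r0 b0.
rewrite (_ : _ `&` _ = [set x | forall k,
  (`]0%R, tnth b k]%classic `&` `]0%R, tnth r k[%classic) (tnth x k)]).
  rewrite (@lebesgueN_box _ _
    (fun k => `]0%R, tnth b k]%classic `&` `]0%R, tnth r k[%classic));
    last by move=> k; exact: measurableI.
  rewrite -prodEFin; apply: eq_bigr => k _.
  have [rb|br] := leP (tnth r k) (tnth b k).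
    rewrite setIidr; first by rewrite lebesgue_measure_itv/= lte_fin r0 sube0.
    by apply: subset_itvl; rewrite bnd_simp.
  rewrite setIidl; first by rewrite lebesgue_measure_itv/= lte_fin b0 sube0.
  by apply: subset_itvl; rewrite bnd_simp.
apply/seteqP; split=> x; rewrite /closed_box /lower_box /=.
  by move=> [xb xr] k; split; rewrite /= in_itv /=; [exact: xb|exact: xr].
by move=> xbr; split=> k; have [] := xbr k; rewrite /= !in_itv.
Qed.

Lemma integral_g_abc (R : realType) (d : nat) (a b : d.-tuple R) (c : R) r :
  orthant a -> (forall k, tnth a k <= tnth b k) -> 0 <= c <= 1 -> orthant r ->
  (\int[lebesgueN d]_(x in lower_box r) (Normc.normc (g_abc a b c x))%:E)%E =
  (\prod_(k < d) Num.min (tnth r k) (tnth b k)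
   - c * \prod_(k < d) Num.min (tnth r k) (tnth a k))%:E.
Proof.
move=> a0 ab c01 r0; have /andP[c0 c1] := c01.
have b0 : orthant b by move=> k; exact: lt_le_trans (ab k).
have mr : measurable (lower_box r).
  rewrite (_ : lower_box r =
      [set x | forall k, `]0%R, tnth r k[%classic (tnth x k)]).
    apply: (@measurable_tuple_box _ _ (fun k => `]0%R, tnth r k[%classic)) => k.
    exact: measurable_itv.
  by apply/seteqP; split=> x bx k; have := bx k; rewrite /= in_itv.
have mb := measurable_closed_box b.
have ma := measurable_closed_box a.
have g0 x := closed_box_indic_gap x ab c01.
under eq_integral do rewrite g_abcE normc_real ger0_norm//.
have mi e : measurable (closed_box e) ->
    measurable_fun (lower_box r) (\1_(closed_box e) : d.-tuple R -> R).
  by move=> me; exact: measurable_indic.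
have mA : measurable_fun (lower_box r)
    (fun x : d.-tuple R => (c%:E * (\1_(closed_box a) x)%:E)%E : \bar R).
  by apply/measurable_EFinP; apply: measurable_funM => //; exact: mi.
have mG : measurable_fun (lower_box r)
    (fun x : d.-tuple R =>
      (\1_(closed_box b) x - c * \1_(closed_box a) x)%:E : \bar R).
  apply/measurable_EFinP; apply: measurable_funB; first exact: mi.
  by apply: measurable_funM => //; exact: mi.
(* Adding [c 1_(B_a)] back avoids integrating a signed function. *)
have : (\int[lebesgueN d]_(x in lower_box r)
      ((\1_(closed_box b) x - c * \1_(closed_box a) x)%:E
       + c%:E * (\1_(closed_box a) x)%:E) =
   \int[lebesgueN d]_(x in lower_box r) (\1_(closed_box b) x)%:E)%E.
  by apply: eq_integral => x _; rewrite -EFinM -EFinD subrK.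
rewrite ge0_integralD//; last 2 first.
  by move=> x _; rewrite lee_fin.
  by move=> x _; rewrite -EFinM lee_fin mulr_ge0.
rewrite ge0_integralZl//; last by apply/measurable_EFinP; exact: mi.
rewrite !integral_indic// => split_b.
have {}split_b : (\int[lebesgueN d]_(x in lower_box r)
      (\1_(closed_box b) x - c * \1_(closed_box a) x)%:E
    + (c * \prod_(k < d) Num.min (tnth r k) (tnth a k))%:E =
    (\prod_(k < d) Num.min (tnth r k) (tnth b k))%:E)%E.
  by rewrite EFinM -!lebesgueN_box_cap.
by rewrite EFinB -split_b addeK.
Qed.

Lemma RMGM_abc (R : realType) (d : nat) (a b : d.-tuple R) (c : R) :
  orthant a -> (forall k, tnth a k <= tnth b k) -> a != b -> 0 <= c < 1 ->
  RMGM ((1 + c) / (1 - c)) [tuple 1 | k < d] (g_abc a b c).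
Proof.
move=> a0 ab neq_ab /andP[c0 c1].
have b0 : orthant b by move=> k; exact: lt_le_trans (ab k).
have c1' : 0 < 1 - c by rewrite subr_gt0.
split.
- by rewrite ler_pdivlMr// mul1r lerD2l ge0_cp.
- by move=> k; rewrite tnth_mktuple.
exists (mu_abc a b c); first exact: canonical_potential_abc.
move=> r r0; rewrite majorant_abc//.
rewrite (_ : mulT _ r = r); last first.
  by apply: eq_from_tnth => k; rewrite !tnth_mktuple mul1r.
rewrite integral_g_abc ?c0 ?(ltW c1)// -EFinM lee_fin.
set B := \prod_(k < d) Num.min _ (tnth b k).
set A := \prod_(k < d) Num.min _ (tnth a k).
have AB : A <= B.
  apply: ler_prod => k _; rewrite !le_min !ge_min lexx ab orbT !andbT.
  by apply/andP; split; exact: ltW.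
rewrite mulrAC ler_pdivlMr//.
(* The difference of the two sides is [2 c (B - A)]. *)
by have := ler_wpM2l c0 AB; nra.
Qed.

(** * Failure of monotonicity and of factorization *)

Lemma not_nonincreasing_abc (R : realType) (d : nat) (a b : d.-tuple R) (c : R)
    k :
  orthant a -> (forall j, tnth a j <= tnth b j) -> tnth a k < tnth b k ->
  0 < c -> ~ nonincreasing_in k (g_abc a b c).
Proof.
move=> a0 ab abk c0.
pose y := [tuple if j == k then tnth b j else tnth a j | j < d].
have ay j : tnth a j <= tnth y j by rewrite tnth_mktuple; case: ifP.
have yb j : tnth y j <= tnth b j by rewrite tnth_mktuple; case: ifP.
have y0 : orthant y by move=> j; exact: lt_le_trans (ay j).
move=> /(_ a y a0 y0); rewrite !g_abcE lecR !indicE.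
have -> : a \in closed_box b by rewrite inE => j; rewrite a0 ab.
have -> : a \in closed_box a by rewrite inE => j; rewrite a0 lexx.
have -> : y \in closed_box b by rewrite inE => j; rewrite y0 yb.
have -> : (y \in closed_box a) = false.
  apply: memNset => /(_ k); rewrite tnth_mktuple eqxx.
  by case/andP=> _; rewrite leNgt abk.
rewrite mulr0 mulr1 subr0 lerDl oppr_ge0 => H.
move: c0; rewrite ltNge => /negP; apply.
apply: H => // j jk.
by rewrite tnth_mktuple (negbTE jk).
Qed.

Definition splice (R : realType) (d : nat) (s t : d.-tuple R) (A : {set 'I_d})
  : d.-tuple R := [tuple if l \in A then tnth t l else tnth s l | l < d].

(** For each coordinate [k], both sides contain the same two factors, evaluated
at the [k]-th coordinates selected by [A] and by [B]: membership in the union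
and in the intersection only permutes them.  The sets [S k] and [T k] confine
the two points on which the factorization is tested. *)
Lemma tensor_product_splice (R : realType) (d : nat) (g : d.-tuple R -> R[i])
    (S T : 'I_d -> set R) :
  (forall k, measurable (S k) /\ lebesgue_measure (S k) != 0%E) ->
  (forall k, measurable (T k) /\ lebesgue_measure (T k) != 0%E) ->
  (forall k u, S k u \/ T k u -> 0 < u) ->
  tensor_product g ->
  exists s t : d.-tuple R,
    [/\ forall k, S k (tnth s k), forall k, T k (tnth t k) &
      forall A B : {set 'I_d}, g (splice s t A) * g (splice s t B) =
        g (splice s t (A :|: B)) * g (splice s t (A :&: B))].
Proof.
move=> HS HT ST0 [_ [F _ gF]].
have [s [t [Ss Tt gst]]] := ae_lebesgueN_grid HS HT gF.
exists s, t; split=> // A B.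
have gE C : g (splice s t C) =
    \prod_(k < d) F k (if k \in C then tnth t k else tnth s k).
  rewrite gst; first by apply: eq_bigr => k _; rewrite tnth_mktuple.
    by move=> k; rewrite tnth_mktuple; case: ifP => _; [right|left].
  move=> k; rewrite tnth_mktuple.
  by apply: (ST0 k); case: ifP => _; [right|left].
rewrite !gE -!big_split/=; apply: eq_bigr => k _; rewrite !inE.
by case: (k \in A); case: (k \in B) => //=; rewrite mulrC.
Qed.

Lemma not_tensor_product_abc (R : realType) (d : nat) (a b : d.-tuple R)
    (c : R) (j k : 'I_d) :
  orthant a -> (forall k, tnth a k < tnth b k) -> c != 0 -> j != k ->
  ~ tensor_product (g_abc a b c).
Proof.
move=> a0 ab c0 jk.
pose S l := `]0%R, tnth a l]%classic.
pose T l := `]tnth a l, tnth b l]%classic.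
have HS l : measurable (S l) /\ lebesgue_measure (S l) != 0%E.
  split; first exact: measurable_itv.
  by rewrite lebesgue_measure_itv/= lte_fin a0 sube0 eqe gt_eqF.
have HT l : measurable (T l) /\ lebesgue_measure (T l) != 0%E.
  split; first exact: measurable_itv.
  by rewrite lebesgue_measure_itv/= lte_fin ab -EFinB eqe subr_eq0 gt_eqF.
have ST0 l u : S l u \/ T l u -> 0 < u.
  rewrite /S /T/= !in_itv/= => -[/andP[]//|/andP[+ _]].
  exact: lt_trans.
move=> /(tensor_product_splice HS HT ST0)[s [t [Ss Tt gst]]].
have gE (A : {set 'I_d}) :
    g_abc a b c (splice s t A) = (1 - c * (A == finset.set0)%:R)%:C%C.
  rewrite g_abcE !indicE.
  have -> : splice s t A \in closed_box b.
    rewrite inE => l; rewrite tnth_mktuple.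
    have := Ss l; have := Tt l; rewrite /S /T /= !in_itv/=.
    move=> /andP[alt tb] /andP[s0 sa]; case: ifP => _.
      by rewrite tb (lt_trans _ alt).
    by rewrite s0 (le_trans sa)// ltW.
  congr ((_ - _ * (nat_of_bool _)%:R)%:C%C).
  apply/idP/eqP => [|->].
    rewrite inE => xa; apply/setP => l; rewrite inE; apply/negP => lA.
    have := xa l; rewrite tnth_mktuple lA leNgt => /andP[_ /negP]; apply.
    by have := Tt l; rewrite /T /= in_itv => /andP[].
  rewrite inE => l; rewrite tnth_mktuple inE.
  by have := Ss l; rewrite /S /= in_itv.
have := gst [set j]%SET [set k]%SET; rewrite !gE.
have n1 l : ([set l]%SET == finset.set0 :> {set 'I_d}) = false.
  by apply/negP => /eqP/setP/(_ l); rewrite !inE eqxx.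
have -> : ([set j] :|: [set k] == finset.set0 :> {set 'I_d})%SET = false.
  by apply/negP => /eqP/setP/(_ j); rewrite !inE eqxx.
have -> : ([set j] :&: [set k] == finset.set0 :> {set 'I_d})%SET.
  apply/eqP/setP => l; rewrite !inE; apply/negP => /andP[/eqP->].
  by apply/negP.
rewrite !n1 -!rmorphM => /complexI.
rewrite !mulr0 !mulr1 subr0 !mul1r => /eqP.
by rewrite -subr_eq0 opprB addrC subrK (negbTE c0).
Qed.

Theorem proposition5p5 (R : realType) (d : nat) (hd : (2 <= d)%N)
    (a b : d.-tuple R) (c : R)
    (ha : orthant a) (hb : orthant b)
    (hab : forall k : 'I_d, tnth a k < tnth b k)
    (hc0 : 0 < c) (hc1 : c < 1) :
  [/\ canonical_potential (mu_abc a b c) (g_abc a b c),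
      RMGM ((1 + c) / (1 - c)) [tuple 1 | k < d] (g_abc a b c),
      forall x, orthant x -> 0 <= g_abc a b c x,
      forall k : 'I_d, tnth a k < tnth b k ->
        ~ nonincreasing_in k (g_abc a b c) &
      (exists j k : 'I_d,
         [/\ j != k, tnth a j < tnth b j & tnth a k < tnth b k]) ->
        ~ tensor_product (g_abc a b c)].
Proof.
have ab k : tnth a k <= tnth b k by exact: ltW.
have neq_ab : a != b.
  by apply/eqP => E; have := hab (Ordinal (ltnW hd)); rewrite E ltxx.
have c01 : 0 <= c <= 1 by rewrite !ltW.
split.
- by apply: canonical_potential_abc => //; exact: ltW.
- by apply: RMGM_abc => //; rewrite ltW.
- by move=> x _; rewrite g_abcE lecR closed_box_indic_gap.
- by move=> k abk; exact: not_nonincreasing_abc.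
- move=> [j [k [jk _ _]]]; apply: (not_tensor_product_abc ha hab _ jk).
  by rewrite gt_eqF.
Qed.
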